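(* If $L$ is a finite meet-semidistributive lattice, then $L$ is crosscut-simplicial.
   Context: All posets and lattices are finite. A lattice $L$ is meet-semidistributive if for all $x,y,z\in L$, $x\wedge z=y\wedge z$ implies $(x\vee y)\wedge z=x\wedge z$. For $x\le y$ in $L$, an atom of the interval $[x,y]=\{z: x\le z\le y\}$ is an element $z$ covering $x$ with $z\le y$. A lattice $L$ is crosscut-simplicial if for every interval $[x,y]$ of $L$ and every proper subset $B$ of the set of atoms of $[x,y]$, the join of $B$ computed in $[x,y]$ (so the empty join is $x$) is not equal to $y$. *)

(* Defs.v *)
From HB Require Import structures.
From mathcomp Require Import all_boot all_order.

Set Implicit Arguments.
Unset Strict Implicit.
Unset Printing Implicit Defensive.

Import Order.TTheory.
Local Open Scope order_scope.

(* [finLatticeType] rather than [finTBLatticeType]: the latter is the case of a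
   nonempty carrier, with chosen bottom and top, and neither is used here. *)

Definition meet_semidistributive (d : Order.disp_t) (L : finLatticeType d) : Prop :=
  forall x y z : L, x `&` z = y `&` z -> (x `|` y) `&` z = x `&` z.

Definition covers (d : Order.disp_t) (L : finLatticeType d) (z x : L) : bool :=
  (x < z) && [forall t : L, ~~ (x < t < z)].

Definition interval_atoms (d : Order.disp_t) (L : finLatticeType d) (x y : L) :
    {set L} :=
  [set z : L | covers z x & z <= y].

(* The bottom of [x, y] is x, so joins in [x, y] are folded from x: the empty
   join is x, and x changes no nonempty join of elements of [x, y]. *)
Definition interval_join (d : Order.disp_t) (L : finLatticeType d) (x : L)
    (B : {set L}) : L :=
  \big[Order.join/x]_(b in B) b.

Definition crosscut_simplicial (d : Order.disp_t) (L : finLatticeType d) : Prop :=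
  forall x y : L, x <= y ->
  forall B : {set L}, B \proper interval_atoms x y -> interval_join x B <> y.

(* Main.v *)
Require Import Defs.
From mathcomp Require Import all_boot all_order.

(** Let [B] omit an atom [a] of [[x, y]].  Distinct atoms meet in [x], so every
    element of [B] meets [a] in [x]; meet-semidistributivity says that the
    elements meeting [a] in [x] are closed under joins, so the join of [B] also
    meets [a] in [x] ([meet_interval_join]).  But [y] lies above [a], hence
    meets [a] in [a], which is not [x]. *)

Import Order.TTheory.
Local Open Scope order_scope.

(** The meet lies between [x] and either element; were it not [x], the two
    covers would both be equal to it. *)
Lemma meet_distinct_covers (d : Order.disp_t) (L : finLatticeType d)
    (x a b : L) :
  covers a x -> covers b x -> a != b -> b `&` a = x.
Proof.
move=> /andP[lt_xa /forallP min_a] /andP[lt_xb /forallP min_b] neq_ab.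
have le_xm : x <= b `&` a by rewrite lexI !ltW.
apply/eqP; apply: contraNT neq_ab => neq_mx.
have lt_xm : x < b `&` a by rewrite lt_neqAle eq_sym neq_mx.
have := min_a (b `&` a); have := min_b (b `&` a).
rewrite lt_xm /= !lt_neqAle leIl leIr !andbT !negbK => /eqP mb /eqP ma.
by rewrite -ma mb.
Qed.

(** The hypothesis [x <= a] serves the empty join, which is [x]. *)
Lemma meet_interval_join (d : Order.disp_t) (L : finLatticeType d)
    (x a : L) (B : {set L}) :
  meet_semidistributive L -> x <= a -> (forall b, b \in B -> b `&` a = x) ->
  interval_join x B `&` a = x.
Proof.
move=> sdL le_xa meetB; apply: (big_ind (fun u => u `&` a = x)) => //.
  exact: meet_l.
by move=> u v ua va; rewrite sdL ?ua ?va.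
Qed.

Theorem theorem1p2 (d : Order.disp_t) (L : finLatticeType d) :
  meet_semidistributive L -> crosscut_simplicial L.
Proof.
move=> sdL x y _ B /properP[/subsetP sBA [a]].
rewrite inE => /andP[cov_a le_ay] notBa joinB.
have lt_xa : x < a by case/andP: cov_a.
have meetB b : b \in B -> b `&` a = x.
  move=> Bb; have := sBA b Bb; rewrite inE => /andP[cov_b _].
  by apply: meet_distinct_covers => //; apply: contraNneq notBa => ->.
have := meet_interval_join _ _ _ _ _ sdL (ltW lt_xa) meetB.
by rewrite joinB meet_r // => eq_ax; rewrite eq_ax ltxx in lt_xa.
Qed.
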